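(* Let $n\ge 2$. For every $p\in\mathbb Z$, the map $\Phi_p\colon BB_n\to B_n$ that sends $$\sigma_k^{\pm1}\mapsto\sigma_k^{\pm1},\qquad b_{ij}\mapsto A_{ij}^p,\qquad b_{ij}^{(l_1,\dots,l_k)}\mapsto A_{i,l_1}\cdots A_{i,l_k}\,A_{ij}^p\,A_{i,l_k}^{-1}\cdots A_{i,l_1}^{-1}\quad(i<l_1<\dots<l_k<j),$$ where $A_{ij}^p$ is the $p$-th power of the right pure braid generator $A_{ij}$, defines a homomorphism of monoids which is surjective but not injective. For $p=0$, $\Phi_0$ is the forgetful map trivializing all bonds (it sends every bond to $1$ and each $\sigma_k^{\pm1}$ to itself).
   Context: $B_n$ is the Artin braid group with generators $\sigma_1,\dots,\sigma_{n-1}$ and relations $\sigma_i\sigma_j=\sigma_j\sigma_i$ for $|i-j|>1$ and $\sigma_i\sigma_{i+1}\sigma_i=\sigma_{i+1}\sigma_i\sigma_{i+1}$; the right pure braid generators are $A_{ij}=\sigma_i^{-1}\cdots\sigma_{j-2}^{-1}\sigma_{j-1}^2\sigma_{j-2}\cdots\sigma_i\in B_n$, $1\le i<j\le n$. The bonded braid monoid $BB_n$ is the monoid generated by $\sigma_i^{\pm1}$ ($1\le i\le n-1$) and the bonds $b_{ij}^{\mathcal I}$ for $1\le i<j\le n$ and $\mathcal I\subseteq\{i+1,\dots,j-1\}$ (written $b_{ij}^{(l_1,\dots,l_k)}$ when $\mathcal I=\{l_1<\dots<l_k\}$); write $b_{ij}=b_{ij}^{\emptyset}$ and $b_i=b_{i,i+1}$.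 The defining relations are $\sigma_i\sigma_i^{-1}=\sigma_i^{-1}\sigma_i=1$ and: 1) $\sigma_i\sigma_j=\sigma_j\sigma_i$ for $|i-j|>1$. 2) $\sigma_i\sigma_{i+1}\sigma_i=\sigma_{i+1}\sigma_i\sigma_{i+1}$ for all $i$. 3) $b_{ij}^{\mathcal I}b_{rs}^{\mathcal R}=b_{rs}^{\mathcal R}b_{ij}^{\mathcal I}$ for $i<j<r<s$ and all $\mathcal I,\mathcal R$. 4) $b_{ij}^{\mathcal I}b_{rs}^{\mathcal R}=b_{rs}^{\mathcal R}b_{ij}^{\mathcal I}$ for $i<r<s<j$ whenever either $r,s\in\mathcal I$ and $\mathcal R\subseteq\mathcal I\cap\{r+1,\dots,s-1\}$, or $r,s\notin\mathcal I$ and $\mathcal I\cap\{r+1,\dots,s-1\}\subseteq\mathcal R$. 5.1) $\sigma_i^{-1}b_{i+1,j}^{\mathcal I}\sigma_i=b_{ij}^{\mathcal I}$ for $j-i>1$, $\mathcal I\subseteq\{i+2,\dots,j-1\}$. 5.2) $\sigma_i b_{i+1,j}^{\mathcal I}\sigma_i^{-1}=b_{ij}^{\{i+1\}\cup\mathcal I}$ for $j-i>1$, $\mathcal I\subseteq\{i+2,\dots,j-1\}$. 5.3) $\sigma_{j-1}b_{i,j-1}^{\mathcal I}\sigma_{j-1}^{-1}=b_{ij}^{\mathcal I}$ for $j-i>1$, $\mathcal I\subseteq\{i+1,\dots,j-2\}$. 5.4) $\sigma_{j-1}^{-1}b_{i,j-1}^{\mathcal I}\sigma_{j-1}=b_{ij}^{\mathcal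 I\cup\{j-1\}}$ for $j-i>1$, $\mathcal I\subseteq\{i+1,\dots,j-2\}$. 6) $\sigma_ib_i=b_i\sigma_i$ for $1\le i\le n-1$. 7) $\sigma_ib_{rs}^{\mathcal R}=b_{rs}^{\mathcal R}\sigma_i$ for $i+1<r$ or $i>s$. 8.1) $\sigma_ib_{rs}^{\mathcal R}=b_{rs}^{\mathcal R}\sigma_i$ for $r<i<s-1$ when $i,i+1\in\mathcal R$ or $i,i+1\notin\mathcal R$. 8.2) $\sigma_ib_{rs}^{\mathcal R}=b_{rs}^{\mathcal R'}\sigma_i$ for $r<i<s-1$, where $\mathcal R,\mathcal R'\subseteq\{r+1,\dots,s-1\}$ are equal except that $i\in\mathcal R$, $i+1\notin\mathcal R$, $i\notin\mathcal R'$, $i+1\in\mathcal R'$. 9.1) $b_i\sigma_{i+1}\sigma_i=\sigma_{i+1}\sigma_ib_{i+1}$ for $1\le i<n-1$. 9.2) $\sigma_i\sigma_{i+1}b_i=b_{i+1}\sigma_i\sigma_{i+1}$ for $1\le i<n-1$. (All strand indices in $\{1,\dots,n\}$.) *)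

(* Defs.v *)
From HB Require Import structures.
From mathcomp Require Import all_boot ssralg ssrint.
From mathcomp Require Import boolp.

Set Implicit Arguments.
Unset Strict Implicit.
Unset Printing Implicit Defensive.

Local Open Scope group_scope.
Local Open Scope quotient_scope.

(** * Monoids and groups given by generators and relations *)

Section PresentedMonoid.
Variables (X : choiceType) (R : seq X -> seq X -> Prop).

Inductive pres_cong : seq X -> seq X -> Prop :=
| PresRel u v w z : R u v -> pres_cong (w ++ u ++ z) (w ++ v ++ z)
| PresRefl u : pres_cong u u
| PresSym u v : pres_cong u v -> pres_cong v u
| PresTrans u v w : pres_cong u v -> pres_cong v w -> pres_cong u w.

Definition pres_eq : rel (seq X) := fun u v => `[< pres_cong u v >].

Lemma pres_eq_refl : reflexive pres_eq.
Proof. by move=> u; apply/asboolP; apply: PresRefl. Qed.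

Lemma pres_eq_sym : symmetric pres_eq.
Proof. by move=> u v; apply/asboolP/asboolP; apply: PresSym. Qed.

Lemma pres_eq_trans : transitive pres_eq.
Proof.
move=> v u w /asboolP uv /asboolP vw; apply/asboolP.
exact: PresTrans uv vw.
Qed.

Canonical pres_equiv := EquivRel pres_eq pres_eq_refl pres_eq_sym pres_eq_trans.

Definition pres_monoid := {eq_quot pres_equiv}.
HB.instance Definition _ := Choice.on pres_monoid.
HB.instance Definition _ := EqQuotient.on pres_monoid.

Definition pres_word (u : seq X) : pres_monoid := \pi_pres_monoid u.

Lemma pres_wordP u v : pres_word u = pres_word v <-> pres_cong u v.
Proof.
rewrite /pres_word; split=> [/eqquotP /asboolP //|uv].
by apply/eqquotP/asboolP.
Qed.

Lemma pres_cong_ctx w z u v :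
  pres_cong u v -> pres_cong (w ++ u ++ z) (w ++ v ++ z).
Proof.
elim=> {u v} [u v w' z' uv|u|u v _ |u v t _ uv _ vt].
- have := PresRel (w ++ w') (z' ++ z) uv.
  by rewrite -!catA.
- exact: PresRefl.
- exact: PresSym.
- exact: PresTrans uv vt.
Qed.

Lemma pres_cong_cat u u' v v' :
  pres_cong u u' -> pres_cong v v' -> pres_cong (u ++ v) (u' ++ v').
Proof.
move=> uu' vv'; apply: (PresTrans (v := u' ++ v)).
  exact: (pres_cong_ctx [::] v uu').
by have := pres_cong_ctx u' [::] vv'; rewrite !cats0.
Qed.

Definition pres_mul (x y : pres_monoid) : pres_monoid :=
  pres_word (repr x ++ repr y).

Lemma repr_pres_word u : pres_cong (repr (pres_word u)) u.
Proof. by apply/pres_wordP; rewrite /pres_word reprK. Qed.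

Lemma pres_word_cat u v : pres_word (u ++ v) = pres_mul (pres_word u) (pres_word v).
Proof.
apply/pres_wordP; apply: PresSym.
by apply: pres_cong_cat; apply: repr_pres_word.
Qed.

Lemma pres_word_surj (x : pres_monoid) : exists u, x = pres_word u.
Proof. by exists (repr x); rewrite /pres_word reprK. Qed.

Lemma pres_mulA : associative pres_mul.
Proof.
move=> x y z; have [u ->] := pres_word_surj x.
have [v ->] := pres_word_surj y; have [w ->] := pres_word_surj z.
by rewrite -!pres_word_cat catA.
Qed.

Lemma pres_mul1 : left_id (pres_word [::]) pres_mul.
Proof. by move=> x; have [u ->] := pres_word_surj x; rewrite -pres_word_cat. Qed.

Lemma pres_mulr1 : right_id (pres_word [::]) pres_mul.
Proof.
by move=> x; have [u ->] := pres_word_surj x; rewrite -pres_word_cat cats0.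
Qed.

HB.instance Definition _ :=
  isMonoid.Build pres_monoid pres_mulA pres_mul1 pres_mulr1.

Definition pres_gen (x : X) : pres_monoid := pres_word [:: x].

Lemma pres_wordM u v : pres_word (u ++ v) = pres_word u * pres_word v.
Proof. exact: pres_word_cat. Qed.

Lemma pres_word_rel u v : R u v -> pres_word u = pres_word v.
Proof.
by move=> uv; apply/pres_wordP; have := PresRel [::] [::] uv; rewrite !cats0.
Qed.

End PresentedMonoid.

Section PresentedGroup.
(* Group words are words in signed letters: [(x, true)] is the generator [x],
   [(x, false)] its inverse. *)
Variables (X : choiceType) (R : seq (X * bool) -> seq (X * bool) -> Prop).

Inductive group_rel : seq (X * bool) -> seq (X * bool) -> Prop :=
| GroupRel u v : R u v -> group_rel u v
| GroupCancel x e : group_rel [:: (x, e); (x, ~~ e)] [::].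

Definition pres_group := pres_monoid group_rel.
HB.instance Definition _ := Monoid.on pres_group.

Definition inv_letter (l : X * bool) := (l.1, ~~ l.2).
Definition inv_word (u : seq (X * bool)) := rev (map inv_letter u).

Definition pres_inv (x : pres_group) : pres_group :=
  pres_word group_rel (inv_word (repr x)).

Lemma inv_wordK : involutive inv_word.
Proof.
move=> u; rewrite /inv_word map_rev revK -map_comp.
by rewrite -[RHS]map_id; apply: eq_map => -[x e]; rewrite /= /inv_letter /= negbK.
Qed.

Lemma pres_word_inv u :
  pres_word group_rel (u ++ inv_word u) = pres_word group_rel [::].
Proof.
elim: u => [//|[x e] u IHu].
rewrite /inv_word /= rev_cons -cats1 catA -cat1s 2!pres_wordM IHu -!pres_wordM /=.
exact/pres_word_rel/GroupCancel.
Qed.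

Lemma pres_mulgV : right_inverse (1 : pres_group) pres_inv *%g.
Proof.
move=> x; rewrite -[X in X * _](reprK x) /pres_inv.
by rewrite -[LHS](pres_wordM group_rel) pres_word_inv.
Qed.

Lemma pres_mulVg : left_inverse (1 : pres_group) pres_inv *%g.
Proof.
move=> x; rewrite -[X in _ * X](reprK x) /pres_inv.
rewrite -[LHS](pres_wordM group_rel) -{2}[repr x]inv_wordK.
exact: pres_word_inv.
Qed.

HB.instance Definition _ := hasInv.Build pres_group pres_inv.
HB.instance Definition _ := Monoid_isGroup.Build pres_group pres_mulVg pres_mulgV.

Definition pres_ggen (x : X) : pres_group := pres_gen group_rel (x, true).

End PresentedGroup.

Definition expgz (G : groupType) (x : G) (p : int) : G :=
  match p with Posz m => x ^+ m | Negz m => x ^- m.+1 end.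

(** * Braid groups

   Strands and crossings are numbered from 0: the strand [i : 'I_n] is the
   usual strand i+1, and [k : 'I_n.-1] stands for sigma_(k+1), which involves
   the strands k and k+1 of ['I_n].  All formulas and relations below are
   invariant under this shift. *)

Section Braids.
Variable n : nat.

Inductive braid_rel : seq ('I_n.-1 * bool) -> seq ('I_n.-1 * bool) -> Prop :=
| BraidFar (k l : 'I_n.-1) :
    (k.+1 < l)%N || (l.+1 < k)%N ->
    braid_rel [:: (k, true); (l, true)] [:: (l, true); (k, true)]
| BraidNear (k l : 'I_n.-1) :
    l = k.+1 :> nat ->
    braid_rel [:: (k, true); (l, true); (k, true)]
              [:: (l, true); (k, true); (l, true)].

Definition braid_group := pres_group braid_rel.
HB.instance Definition _ := Group.on braid_group.

Definition sigma (k : 'I_n.-1) : braid_group := pres_ggen braid_rel k.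

(* [sigma] at a natural number, with default value 1 out of range. *)
Definition sigman (k : nat) : braid_group := oapp sigma 1 (insub k).

(* A_ij = sigma_i^-1 .. sigma_(j-2)^-1 sigma_(j-1)^2 sigma_(j-2) .. sigma_i *)
Definition pureA (i j : 'I_n) : braid_group :=
  (\prod_(i <= k < j.-1) (sigman k)^-1) * sigman j.-1 ^+ 2 *
  (\prod_(k <- rev (index_iota i j.-1)) sigman k).

(** * Bonded braid monoids *)

Definition strands_between (i j : 'I_n) : {set 'I_n} := [set l : 'I_n | (i < l < j)%N].

(* [((i, j), I)] encodes the bond b_ij^I. *)
Definition bond_axiom (t : 'I_n * 'I_n * {set 'I_n}) :=
  (t.1.1 < t.1.2)%N && (t.2 \subset strands_between t.1.1 t.1.2).

Record bond := Bond { bond_val :> 'I_n * 'I_n * {set 'I_n};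
                      bond_valP : bond_axiom bond_val }.
HB.instance Definition _ := [isSub for bond_val].
HB.instance Definition _ := [Choice of bond by <:].

Definition bond_l (b : bond) : 'I_n := b.1.1.
Definition bond_r (b : bond) : 'I_n := b.1.2.
Definition bond_set (b : bond) : {set 'I_n} := b.2.

Definition bonded_letter := ('I_n.-1 * bool + bond)%type.
HB.instance Definition _ := Choice.on bonded_letter.

Definition ps (k : 'I_n.-1) : bonded_letter := inl (k, true).
Definition ns (k : 'I_n.-1) : bonded_letter := inl (k, false).
Definition bd (b : bond) : bonded_letter := inr b.

(* Bonds are specified by their ends and set: the bounds i < j and
   I \subset {i+1, .., j-1} are part of the type [bond]. *)
Inductive bonded_rel : seq bonded_letter -> seq bonded_letter -> Prop :=
| BondedBraid u v :
    group_rel braid_rel u v -> bonded_rel (map inl u) (map inl v)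
| BondFar (b c : bond) :
    (bond_r b < bond_l c)%N ->
    bonded_rel [:: bd b; bd c] [:: bd c; bd b]
| BondNested (b c : bond) :
    (bond_l b < bond_l c)%N -> (bond_r c < bond_r b)%N ->
    [/\ bond_l c \in bond_set b, bond_r c \in bond_set b
      & bond_set c \subset
          bond_set b :&: strands_between (bond_l c) (bond_r c)] \/
    [/\ bond_l c \notin bond_set b, bond_r c \notin bond_set b
      & bond_set b :&: strands_between (bond_l c) (bond_r c)
          \subset bond_set c] ->
    bonded_rel [:: bd b; bd c] [:: bd c; bd b]
(* sigma_i^-1 b_(i+1,j)^I sigma_i = b_ij^I and
   sigma_i b_(i+1,j)^I sigma_i^-1 = b_ij^({i+1} U I), with k = i *)
| BondLeft (k : 'I_n.-1) (b c : bond) :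
    bond_l c = k :> nat -> bond_l b = k.+1 :> nat -> bond_r c = bond_r b ->
    bond_set c = bond_set b ->
    bonded_rel [:: ns k; bd b; ps k] [:: bd c]
| BondLeftU (k : 'I_n.-1) (b c : bond) :
    bond_l c = k :> nat -> bond_l b = k.+1 :> nat -> bond_r c = bond_r b ->
    bond_set c = bond_l b |: bond_set b ->
    bonded_rel [:: ps k; bd b; ns k] [:: bd c]
(* sigma_(j-1) b_(i,j-1)^I sigma_(j-1)^-1 = b_ij^I and
   sigma_(j-1)^-1 b_(i,j-1)^I sigma_(j-1) = b_ij^(I U {j-1}), with k = j-1 *)
| BondRight (k : 'I_n.-1) (b c : bond) :
    bond_r b = k :> nat -> bond_r c = k.+1 :> nat -> bond_l c = bond_l b ->
    bond_set c = bond_set b ->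
    bonded_rel [:: ps k; bd b; ns k] [:: bd c]
| BondRightU (k : 'I_n.-1) (b c : bond) :
    bond_r b = k :> nat -> bond_r c = k.+1 :> nat -> bond_l c = bond_l b ->
    bond_set c = bond_r b |: bond_set b ->
    bonded_rel [:: ns k; bd b; ps k] [:: bd c]
| BondOwn (k : 'I_n.-1) (b : bond) :
    bond_l b = k :> nat -> bond_r b = k.+1 :> nat ->
    bonded_rel [:: ps k; bd b] [:: bd b; ps k]
| BondOutside (k : 'I_n.-1) (b : bond) :
    (k.+1 < bond_l b)%N || (bond_r b < k)%N ->
    bonded_rel [:: ps k; bd b] [:: bd b; ps k]
(* x and y are the strand positions k and k+1 crossed by sigma_k. *)
| BondInside (k : 'I_n.-1) (x y : 'I_n) (b : bond) :
    x = k :> nat -> y = k.+1 :> nat ->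
    (bond_l b < k)%N -> (k.+1 < bond_r b)%N ->
    (x \in bond_set b) && (y \in bond_set b) ||
    (x \notin bond_set b) && (y \notin bond_set b) ->
    bonded_rel [:: ps k; bd b] [:: bd b; ps k]
| BondInsideSwap (k : 'I_n.-1) (x y : 'I_n) (b c : bond) :
    x = k :> nat -> y = k.+1 :> nat ->
    (bond_l b < k)%N -> (k.+1 < bond_r b)%N ->
    bond_l c = bond_l b -> bond_r c = bond_r b ->
    x \in bond_set b -> y \notin bond_set b ->
    x \notin bond_set c -> y \in bond_set c ->
    bond_set b :\: [set x; y] = bond_set c :\: [set x; y] ->
    bonded_rel [:: ps k; bd b] [:: bd c; ps k]
(* b_k sigma_(k+1) sigma_k = sigma_(k+1) sigma_k b_(k+1) and
   sigma_k sigma_(k+1) b_k = b_(k+1) sigma_k sigma_(k+1), with l = k+1 *)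
| BondShiftL (k l : 'I_n.-1) (b c : bond) :
    l = k.+1 :> nat ->
    bond_l b = k :> nat -> bond_r b = k.+1 :> nat ->
    bond_l c = l :> nat -> bond_r c = l.+1 :> nat ->
    bonded_rel [:: bd b; ps l; ps k] [:: ps l; ps k; bd c]
| BondShiftR (k l : 'I_n.-1) (b c : bond) :
    l = k.+1 :> nat ->
    bond_l b = k :> nat -> bond_r b = k.+1 :> nat ->
    bond_l c = l :> nat -> bond_r c = l.+1 :> nat ->
    bonded_rel [:: ps k; ps l; bd b] [:: bd c; ps k; ps l].

Definition bonded_monoid := pres_monoid bonded_rel.
HB.instance Definition _ := Monoid.on bonded_monoid.

Definition bsigma (k : 'I_n.-1) : bonded_monoid := pres_gen bonded_rel (ps k).
Definition bsigmaV (k : 'I_n.-1) : bonded_monoid := pres_gen bonded_rel (ns k).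
Definition bbond (b : bond) : bonded_monoid := pres_gen bonded_rel (bd b).

(* [enum] lists a set of strands in increasing order. *)
Definition Phi_spec (p : int) (Phi : bonded_monoid -> braid_group) : Prop :=
  [/\ forall k, Phi (bsigma k) = sigma k,
      forall k, Phi (bsigmaV k) = (sigma k)^-1,
      forall b, bond_set b = set0 ->
        Phi (bbond b) = expgz (pureA (bond_l b) (bond_r b)) p
    & forall b, Phi (bbond b) =
        (\prod_(l <- enum (bond_set b)) pureA (bond_l b) l) *
        expgz (pureA (bond_l b) (bond_r b)) p *
        (\prod_(l <- rev (enum (bond_set b))) (pureA (bond_l b) l)^-1)].

End Braids.

(* Main.v *)
(** Telescoping the partial products of the A_{i,l} turns the prescribed image of
    b_ij^I into a conjugate w sigma_(j-1)^(2p) w^-1, where w = x_i .. x_(j-2) and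
    x_k is sigma_k if the strand k+1 is in I, and sigma_k^-1 otherwise.  In this
    form every defining relation of BB_n follows from the braid relations by
    peeling off one crossing at a time; for the nested relation, peeling the
    crossings of the inner bond changes the set of the outer bond by
    transpositions of adjacent strands, until the inner bond is elementary.
    Surjectivity holds already on the words without bonds.  Injectivity fails
    because the number of bonds in a word is invariant under the relations,
    while the image of a bond is also the image of a word without bonds. *)

From HB Require Import structures.
Require Import Defs.
From mathcomp Require Import all_boot ssralg ssrint.
From mathcomp Require Import zify.

Local Open Scope group_scope.

(** * Induction on the left end; powers and commutation under conjugation *)

Lemma endpoint_ind (P : nat -> nat -> Prop) :
    (forall i, P i i.+1) ->
    (forall i j, i.+1 < j -> P i.+1 j -> P i j) ->
  forall i j, i < j -> P i j.
Proof.
move=> P1 PS i j /subnKC <-; move: (j - _) => d; elim: d i => [|d IH] i.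
  by rewrite addn0.
by apply: PS; [lia | rewrite -addSnnS].
Qed.

Lemma commute_expgz (G : groupType) (x y : G) p :
  commute x y -> commute x (expgz y p).
Proof. by case: p => m xy /=; [|apply: commuteV]; apply: commuteX. Qed.

Lemma expgzJ (G : groupType) (x y : G) p : expgz (x ^ y) p = expgz x p ^ y.
Proof. by case: p => m /=; rewrite ?conjVg conjXg. Qed.

Lemma conjg_commute (G : groupType) (x y : G) : x ^ y = x <-> commute x y.
Proof.
split=> xy; first by rewrite /commute conjgC xy.
by rewrite conjgE xy mulKg.
Qed.

Lemma commuteJr (G : groupType) (x y z : G) :
  commute (x ^ z^-1) y -> commute x (y ^ z).
Proof.
move=> xy; rewrite /commute -[x](conjgKV z) -!conjMg.
by congr (_ ^ _).
Qed.

(** * Bond images built from a sequence satisfying the braid relations *)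

Section BraidedSequence.
Variables (G : groupType) (m : nat) (s : nat -> G) (p : int).
(** The model is [sigman n] with [m = n.-1]. Its default value 1 respects far commutation at every
    index, but the braid relation only holds while both indices stay below [m]. *)
Hypothesis s_far : forall k l, k.+1 < l -> commute (s k) (s l).
Hypothesis s_near : forall k, k.+1 < m ->
  s k * s k.+1 * s k = s k.+1 * s k * s k.+1.

Let t k := expgz (s k ^+ 2) p.

(** Since [x ^ y] is y^-1 x y, the inverse is what produces s_k x s_k^-1, the form required when the
    crossed strand lies in I. *)
Definition crossing (over : bool) k := if over then (s k)^-1 else s k.

(* [e] is the characteristic function of the set I of b_ij^I, and [d] is
   [j - i - 1].  The crossing of the strands i and i+1 depends on [e i.+1]. *)
Fixpoint bond_rec i d (e : pred nat) : G :=
  if d is d'.+1 then bond_rec i.+1 d' e ^ crossing (e i.+1) i else t i.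

Definition bond_image i j e := bond_rec i (j - i.+1) e.

Lemma bond_image1 i e : bond_image i i.+1 e = t i.
Proof. by rewrite /bond_image subnn. Qed.

Lemma bond_imageS i j e : i.+1 < j ->
  bond_image i j e = bond_image i.+1 j e ^ crossing (e i.+1) i.
Proof.
by move=> ij; rewrite {1}/bond_image; have -> : j - i.+1 = (j - i.+2).+1 by lia.
Qed.

Lemma bond_image_ext i j e e' : i < j ->
  (forall l, i < l < j -> e l = e' l) -> bond_image i j e = bond_image i j e'.
Proof.
move: i j; apply: endpoint_ind => [i|i j ij IH] ee'; first by rewrite !bond_image1.
rewrite (bond_imageS i j e) // (bond_imageS i j e') // IH => [|l /andP[il lj]]; last by rewrite ee' // ltnW.
by rewrite ee' ?ltnSn.
Qed.

Lemma commute_crossing x c k : commute x (s k) -> commute x (crossing c k).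
Proof. by case: c => //= xs; apply: commuteV. Qed.

Lemma commute_t x k : commute x (s k) -> commute x (t k).
Proof. by move=> xs; apply/commute_expgz/commuteX. Qed.

Lemma commute_bond x i j e : i < j ->
  (forall k, i <= k < j -> commute x (s k)) -> commute x (bond_image i j e).
Proof.
move: i j; apply: endpoint_ind => [i|i j ij IH] xs.
  by rewrite bond_image1; apply/commute_t/xs; rewrite leqnn ltnSn.
rewrite bond_imageS //.
have xi : commute x (crossing (e i.+1) i) by apply/commute_crossing/xs; lia.
apply: commuteJr; rewrite (conjg_commute _ _ _).2; last exact: commuteV.
by apply: IH => k /andP[ik kj]; apply: xs; rewrite kj ltnW.
Qed.

Lemma s_apart k l : (k.+1 < l) || (l.+1 < k) -> commute (s k) (s l).
Proof. by case/orP=> /s_far // kl; apply: commute_sym. Qed.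

Lemma t_shift k : k.+1 < m -> t k ^ (s k.+1 * s k) = t k.+1.
Proof.
move=> km; rewrite -expgzJ conjXg; congr (expgz (_ ^+ 2) p).
by rewrite conjgE [X in _ * X]mulgA s_near // mulKg.
Qed.

Lemma t_shiftV k : k.+1 < m -> t k.+1 ^ (s k * s k.+1) = t k.
Proof.
move=> km; rewrite -expgzJ conjXg; congr (expgz (_ ^+ 2) p).
by rewrite conjgE [X in _ * X]mulgA -s_near // mulKg.
Qed.

(** For an elementary bond this is [t_shift] or [t_shiftV], according to e(j); afterwards the new
    crossing at the right end is far from the peeled one at the left end, and the two commute. *)
Lemma bond_image_right i j e : i < j -> j < m ->
  bond_image i j.+1 e = bond_image i j e ^ crossing (~~ e j) j.
Proof.
move: i j; apply: endpoint_ind => [i|i j ij IH] jm.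
  rewrite bond_imageS ?ltnSn // !bond_image1 /crossing.
  case: (e i.+1) => /=.
    by rewrite -(t_shift _ jm) conjgM conjgK.
  by rewrite -(t_shiftV _ jm) conjgM conjgK.
rewrite (bond_imageS i j.+1); last exact: ltnW.
rewrite IH // (bond_imageS i j) // -!conjgM.
congr (_ ^ _); apply/commute_crossing/commute_sym/commute_crossing/commute_sym.
by apply: s_apart; rewrite ij orbT.
Qed.

(** The braid relation with signs. The excluded pattern would read s_(k+1) s_k^-1 s_(k+1) = s_k
    s_(k+1)^-1 s_k, which already fails in the braid group on three strands. *)
Lemma crossing_braid k c c' : k.+1 < m -> c ==> c' ->
  crossing c' k.+1 * crossing c k * s k.+1 =
  s k * crossing c k.+1 * crossing c' k.
Proof.
move=> km; have E := s_near _ km; case: c c' => [] [] //= _; rewrite /crossing.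
- apply: (mulgI (s k.+1)); apply: (mulIg (s k)).
  rewrite -!mulgA mulVKg mulVg mulg1; apply: (mulgI (s k)).
  by apply: (mulIg (s k.+1)); rewrite mulVKg !mulgA mulgVK -E.
- apply: (mulgI (s k.+1)); apply: (mulIg (s k)).
  by rewrite -!mulgA mulVKg mulVg mulg1 !mulgA.
Qed.

(** Crossings before k-1 commute with s_k. At the pair k-1, k, [crossing_braid] exchanges the two
    signs and turns s_k into s_(k-1), which commutes with the remaining bond starting at k+1. *)
Lemma bond_image_swap i j k (e e' : pred nat) :
    i < k -> k.+1 < j -> j <= m -> e k ==> e k.+1 ->
    e' k = e k.+1 -> e' k.+1 = e k ->
    (forall l, l != k -> l != k.+1 -> e' l = e l) ->
  bond_image i j e ^ s k = bond_image i j e'.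
Proof.
move=> ik kj jm ec e'k e'k1 e'E.
have ij : i < j by lia.
move: i j ij ik kj jm; apply: endpoint_ind => [i|i j ij IH] ik kj jm; first by lia.
rewrite (bond_imageS i j) // (bond_imageS i j) //.
case: (ltngtP i.+1 k) => [ik1||ki]; [|lia|].
  rewrite e'E -?IH //; try lia.
  rewrite -!conjgM; congr (_ ^ _).
  by apply/commute_sym/commute_crossing/commute_sym; apply: s_apart; rewrite ik1.
subst k; rewrite (bond_imageS _ j e) // (bond_imageS _ j e') // -!conjgM.
rewrite ?mulgA crossing_braid ?e'k ?e'k1 ?conjgM; try lia.
  congr ((_ ^ _) ^ _); rewrite (conjg_commute _ _ _).2.
    by apply: bond_image_ext => // l /andP[il lj]; rewrite e'E //; lia.
  apply/commute_sym/commute_bond => // l il; apply: s_apart; lia.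
Qed.

Lemma commute_bond_t i j k (e : pred nat) :
  i < k -> k.+1 < j -> j <= m -> e k = e k.+1 -> commute (bond_image i j e) (t k).
Proof.
move=> ik kj jm ee; apply: commute_t; apply/conjg_commute.
by apply: bond_image_swap => //; rewrite ee implybb.
Qed.

Definition swap_pred k (e : pred nat) l :=
  if l == k then e k.+1 else if l == k.+1 then e k else e l.

Lemma bond_image_crossing i j k (c : bool) e :
    i < k -> k.+1 < j -> j <= m -> (if c then e k ==> e k.+1 else e k.+1 ==> e k) ->
  bond_image i j e ^ (crossing c k)^-1 = bond_image i j (swap_pred k e).
Proof.
move=> ik kj jm.
have kk : (k.+1 == k) = false by lia.
case: c => ec.
  rewrite invgK; apply: (bond_image_swap _ _ k) => //; rewrite /swap_pred ?eqxx ?kk //.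
  by move=> l /negbTE-> /negbTE->.
(* Conjugation by s_k^-1 is the exchange read backwards, starting from the swapped predicate. *)
apply: (canLR (conjgK _)); symmetry.
apply: (bond_image_swap _ _ k) => //; rewrite /swap_pred ?eqxx ?kk //.
by move=> l /negbTE-> /negbTE->.
Qed.

(* Peeling the outermost crossing off the inner bond conjugates the outer bond
   by sigma_r^{+-1}, which only exchanges the membership of r and r+1. *)
Lemma commute_bond_nested i j r q (c : bool) (e f : pred nat) :
    i < r -> r < q -> q < j -> j <= m -> e r = c -> e q = c ->
    (forall l, r < l < q -> f l = c -> e l = c) ->
  commute (bond_image i j e) (bond_image r q f).
Proof.
move=> ir rq qj jm; move: r q rq ir qj e.
apply: endpoint_ind => [r|r q rq IH] ir qj e er eq fe.
  by rewrite bond_image1; apply: commute_bond_t; rewrite ?er ?eq.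
rewrite (bond_imageS r q) //; apply: commuteJr; rewrite bond_image_crossing //; try lia.
  have rr : (r.+1 == r) = false by lia.
  (* After the exchange, position r+1, the new left end of the inner bond, carries the old value
     e(r) = c. *)
  apply: IH => //; rewrite /swap_pred ?eqxx ?rr //; try lia.
    by rewrite !ifN //; lia.
  by move=> l lr fl; rewrite !ifN ?fe //; lia.
(* The exchange needs an implication between e(r) and e(r+1), directed by f(r+1). If f(r+1) = c,
   then also e(r+1) = c; otherwise e(r) = c alone gives it. *)
have := fe r.+1; rewrite ltnSn rq => /(_ isT).
rewrite er; clear IH er eq fe.
by case: (f r.+1) (e r.+1) c => [] [] [] //= /(_ erefl).
Qed.

Lemma commute_bond_far i j r q e f :
  i < j -> j < r -> r < q -> commute (bond_image i j e) (bond_image r q f).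
Proof.
move=> ij jr rq; apply: commute_bond => // l rl; apply: commute_sym.
by apply: commute_bond => // k ik; apply: s_apart; lia.
Qed.

(** * Telescoping of products of pure braid generators *)

Definition pure i j : G :=
  (\prod_(i <= k < j.-1) (s k)^-1) * s j.-1 ^+ 2 *
  (\prod_(k <- rev (index_iota i j.-1)) s k).

Lemma pure1 i : pure i i.+1 = s i ^+ 2.
Proof. by rewrite /pure big_geq // /index_iota subnn big_nil mul1g mulg1. Qed.

Lemma pureS i j : i.+1 < j -> pure i j = pure i.+1 j ^ s i.
Proof.
move=> ij; rewrite /pure big_ltn; last by lia.
rewrite {2}/index_iota; have -> : j.-1 - i = (j.-1 - i.+1).+1 by lia.
by rewrite /= rev_cons -cats1 big_cat big_seq1 /= conjgE !mulgA.
Qed.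

(** Passing from i+1 to i conjugates every A_(i+1,l) by s_i. If i+1 is in I, the extra factor
    A_(i,i+1) = s_i^2 turns the outer crossing s_i into s_i^-1. *)
Lemma bond_image_pure i j e : i < j ->
  bond_image i j e =
  expgz (pure i j) p ^ (\prod_(i.+1 <= l < j | e l) pure i l)^-1.
Proof.
move: i j; apply: endpoint_ind => [i|i j ij IH].
  by rewrite bond_image1 pure1 big_geq // invg1 conjg1.
rewrite bond_imageS // IH (pureS i j) // expgzJ -!conjgM; congr (_ ^ _).
have EP : \prod_(i.+2 <= l < j | e l) pure i l =
          (\prod_(i.+2 <= l < j | e l) pure i.+1 l) ^ s i.
  rewrite conjg_prod big_nat_cond [RHS]big_nat_cond.
  by apply: eq_bigr => l /andP[/andP[il _] _]; rewrite pureS.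
rewrite [in RHS]big_ltn_cond //= EP pure1 /crossing.
case: (e i.+1); last by rewrite -conjVg conjgE mulVKg.
rewrite invgM -conjVg conjgE -!mulgA mulVKg; congr (_ * _).
by rewrite expgS expg1 invgM mulVKg.
Qed.

End BraidedSequence.

Arguments crossing {G} s over k.
Arguments bond_image {G} s p i j e.
Arguments pure {G} s i j.

(** * Morphisms out of a presented monoid *)

Section PresentedLift.
Variables (X : choiceType) (R : seq X -> seq X -> Prop) (M : monoidType).
Variable f : X -> M.
Hypothesis fR : forall u v, R u v -> \prod_(x <- u) f x = \prod_(x <- v) f x.

Lemma prod_pres_cong u v :
  pres_cong R u v -> \prod_(x <- u) f x = \prod_(x <- v) f x.
Proof.
elim=> // [{}u {}v w z /fR uv|{}u {}v w _ -> _ ->//].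
by rewrite !big_cat /= uv.
Qed.

Definition pres_lift (x : pres_monoid R) : M := \prod_(y <- repr x) f y.

Lemma pres_lift_word u : pres_lift (pres_word R u) = \prod_(x <- u) f x.
Proof. exact/prod_pres_cong/repr_pres_word. Qed.

Lemma pres_lift_morphism : monoid_morphism pres_lift.
Proof.
split=> [|x y]; first by rewrite [LHS]pres_lift_word big_nil.
have [u ->] := pres_word_surj x; have [v ->] := pres_word_surj y.
by rewrite -[_ * _]pres_wordM !pres_lift_word big_cat.
Qed.

Lemma pres_morphism_exists :
  exists g : UMagmaMorphism.type (pres_monoid R) M,
    forall u, g (pres_word R u) = \prod_(x <- u) f x.
Proof.
pose gM := isUMagmaMorphism.Build (pres_monoid R) M pres_lift pres_lift_morphism.
pose g : UMagmaMorphism.type (pres_monoid R) M := HB.pack pres_lift gM.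
by exists g; apply: pres_lift_word.
Qed.

End PresentedLift.

Lemma pres_morphism_ext (X : choiceType) (R : seq X -> seq X -> Prop)
    (M : monoidType) (g h : UMagmaMorphism.type (pres_monoid R) M) :
  (forall x, g (pres_gen R x) = h (pres_gen R x)) -> g =1 h.
Proof.
move=> gh x; have [u ->] := pres_word_surj x.
elim: u => [|y u IH]; first by rewrite [LHS]gmulf1 [RHS]gmulf1.
by rewrite -cat1s pres_wordM !gmulfM IH; congr (_ * _); apply: gh.
Qed.

(* [big_enum] is only available for commutative operators. *)
Lemma prod_enum (M : monoidType) (I : finType) (A : {pred I}) (F : I -> M) :
  \prod_(x <- enum A) F x = \prod_(x in A) F x.
Proof. by rewrite [index_enum _]unlock -[RHS]big_filter. Qed.

(** * The bonded relations in the braid group *)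

Section BondedBraids.
Variable n : nat.

Lemma sigmaE (k : 'I_n.-1) : sigma k = sigman n k.
Proof. by rewrite /sigman valK. Qed.

Lemma sigma_rel u v : braid_rel u v ->
  pres_word (group_rel (@braid_rel n)) u = pres_word _ v.
Proof. by move=> uv; apply: pres_word_rel; apply: GroupRel. Qed.

(** Inverses are defined through a chosen representative, so the inverse letter is identified by
    uniqueness of inverses. *)
Lemma pres_wordV (k : 'I_n.-1) :
  (sigma k)^-1 = pres_word (group_rel (@braid_rel n)) [:: (k, false)].
Proof.
apply: mulg1_eq; rewrite -[LHS]pres_wordM.
by apply: pres_word_rel; apply: GroupCancel.
Qed.

Lemma sigman_far k l : k.+1 < l -> commute (sigman n k) (sigman n l).
Proof.
move=> kl; rewrite /sigman.
case: insubP => [k' _ Ek|_] /=; last exact/commute_sym/commute1.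
case: insubP => [l' _ El|_] /=; last exact: commute1.
rewrite /commute -[LHS]pres_wordM -[RHS]pres_wordM.
by apply: sigma_rel; apply: BraidFar; rewrite Ek El kl.
Qed.

Lemma sigman_near k : k.+1 < n.-1 ->
  sigman n k * sigman n k.+1 * sigman n k =
  sigman n k.+1 * sigman n k * sigman n k.+1.
Proof.
move=> kn; rewrite /sigman !insubT ?(ltnW kn) //= => kn'.
have E (x y : 'I_n.-1) : sigma x * sigma y * sigma x =
    pres_word _ [:: (x, true); (y, true); (x, true)].
  by rewrite (pres_wordM _ [:: _; _] [:: _]) (pres_wordM _ [:: _] [:: _]).
by rewrite !E; apply: sigma_rel; apply: BraidNear.
Qed.

Definition strand_pred (I : {set 'I_n}) : pred nat :=
  fun l => oapp (fun x : 'I_n => x \in I) false (insub l).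

Lemma strand_predE (I : {set 'I_n}) (x : 'I_n) : strand_pred I x = (x \in I).
Proof. by rewrite /strand_pred valK. Qed.

Lemma bond_lr (b : bond n) : bond_l b < bond_r b.
Proof. by case/andP: (bond_valP b). Qed.

Lemma strand_pred_between (b : bond n) l :
  strand_pred (bond_set b) l -> bond_l b < l < bond_r b.
Proof.
rewrite /strand_pred; case: insubP => //= x _ <- xb.
have /andP[_ /subsetP/(_ x xb)] := bond_valP b.
by rewrite inE.
Qed.

Variable p : int.

Definition braid_bond (b : bond n) : braid_group n :=
  bond_image (sigman n) p (bond_l b) (bond_r b) (strand_pred (bond_set b)).

Lemma braid_bondE (b : bond n) :
  braid_bond b = (\prod_(l <- enum (bond_set b)) pureA (bond_l b) l) *
        expgz (pureA (bond_l b) (bond_r b)) p *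
        (\prod_(l <- rev (enum (bond_set b))) (pureA (bond_l b) l)^-1).
Proof.
rewrite /braid_bond bond_image_pure ?bond_lr // conjgE invgK mulgA.
rewrite prodgV revK prod_enum.
(* Both ordered products are brought to the index type ['I_n]; membership in the bond set already
   forces the interval bounds. *)
rewrite (big_nat_widen _ _ n) ?(ltnW (ltn_ord _)) // big_geq_mkord.
suff E : \prod_(l < n | strand_pred (bond_set b) l && (l < bond_r b) &&
                  (bond_l b < l)) pure (sigman n) (bond_l b) l =
         \prod_(l in bond_set b) pureA (bond_l b) l by rewrite E.
apply: eq_bigl => l; rewrite strand_predE.
have := strand_pred_between b l; rewrite strand_predE.
by case: (_ \in _) => //= /(_ isT)/andP[-> ->].
Qed.

Definition letter_image (x : bonded_letter n) : braid_group n :=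
  match x with
  | inl (k, c) => if c then sigma k else (sigma k)^-1
  | inr b => braid_bond b
  end.

Lemma prod_letter_image_braid u :
  \prod_(x <- map inl u) letter_image x = pres_word (group_rel (@braid_rel n)) u.
Proof.
elim: u => [|[k c] u IH]; first by rewrite big_nil.
rewrite /= big_cons IH -cat1s pres_wordM /=; congr (_ * _).
by case: c; rewrite -?pres_wordV.
Qed.

Lemma strand_predU1 (x : 'I_n) (I : {set 'I_n}) l :
  strand_pred (x |: I) l = (l == x) || strand_pred I l.
Proof.
rewrite /strand_pred; case: insubP => [y _ <-|/=]; first by rewrite /= !inE.
by rewrite -leqNgt orbF => nl; apply/esym/negbTE; have := ltn_ord x; lia.
Qed.

Lemma braid_bond_far (b c : bond n) :
  bond_r b < bond_l c -> commute (braid_bond b) (braid_bond c).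
Proof.
by move=> bc; apply: commute_bond_far; rewrite ?bond_lr //; apply: sigman_far.
Qed.

Lemma braid_bond_nested (b c : bond n) :
    bond_l b < bond_l c -> bond_r c < bond_r b ->
    [/\ bond_l c \in bond_set b, bond_r c \in bond_set b
      & bond_set c \subset
          bond_set b :&: strands_between (bond_l c) (bond_r c)] \/
    [/\ bond_l c \notin bond_set b, bond_r c \notin bond_set b
      & bond_set b :&: strands_between (bond_l c) (bond_r c)
          \subset bond_set c] ->
  commute (braid_bond b) (braid_bond c).
Proof.
move=> lbc rcb sets.
have ext (l : nat) : l < bond_r c -> {x : 'I_n | l = x}.
  by move=> lc; exists (Ordinal (ltn_trans lc (ltn_ord (bond_r c)))).
have rn : bond_r b <= n.-1 by have := ltn_ord (bond_r b); lia.
(* The two alternatives are c = true and c = false of [commute_bond_nested]; in the second the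
   inclusion enters by contraposition. *)
case: sets => -[lcb rcb' /subsetP sub].
  apply: (commute_bond_nested _ n.-1 _ _ sigman_far sigman_near _ _ _ _ true);
    rewrite ?bond_lr ?strand_predE //.
  move=> l /andP[_ /ext[x ->]]; rewrite !strand_predE => /sub.
  by rewrite inE => /andP[].
apply: (commute_bond_nested _ n.-1 _ _ sigman_far sigman_near _ _ _ _ false);
  rewrite ?bond_lr ?strand_predE //; try exact: negbTE.
move=> l /[dup] /andP[_ /ext[x ->]]; rewrite !strand_predE => lxr.
by apply: contraFF => xb; apply: sub; rewrite !inE xb.
Qed.

Lemma braid_bond_left (c : bool) (k : 'I_n.-1) (b d : bond n) :
    bond_l d = k :> nat -> bond_l b = k.+1 :> nat -> bond_r d = bond_r b ->
    bond_set d = (if c then bond_l b |: bond_set b else bond_set b) ->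
  braid_bond d = braid_bond b ^ crossing (sigman n) c k.
Proof.
move=> ld lb rd sd; rewrite /braid_bond rd ld lb.
have kb := bond_lr b; rewrite lb in kb.
have dE l : strand_pred (bond_set d) l =
    c && (l == k.+1) || strand_pred (bond_set b) l.
  by rewrite sd -lb; case: c {sd} => //; rewrite strand_predU1.
rewrite bond_imageS // dE eqxx andbT.
(* k+1 is the left end of [b], hence not in its set, so [c] alone decides the sign. *)
have /negbTE-> : ~~ strand_pred (bond_set b) k.+1.
  by apply/negP => /strand_pred_between; rewrite lb ltnn.
rewrite orbF; congr (_ ^ _); apply: bond_image_ext => // l /andP[kl _].
by rewrite dE (gtn_eqF kl) andbF.
Qed.

Lemma braid_bond_right (c : bool) (k : 'I_n.-1) (b d : bond n) :
    bond_r b = k :> nat -> bond_r d = k.+1 :> nat -> bond_l d = bond_l b ->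
    bond_set d = (if c then bond_r b |: bond_set b else bond_set b) ->
  braid_bond d = braid_bond b ^ crossing (sigman n) (~~ c) k.
Proof.
move=> rb rd ld sd; rewrite /braid_bond rd ld rb.
have kb := bond_lr b; rewrite rb in kb.
have dE l : strand_pred (bond_set d) l =
    c && (l == k) || strand_pred (bond_set b) l.
  by rewrite sd -rb; case: c {sd} => //; rewrite strand_predU1.
rewrite (bond_image_right _ n.-1) //; first last.
- exact: sigman_near.
- exact: sigman_far.
rewrite dE eqxx andbT.
have /negbTE-> : ~~ strand_pred (bond_set b) k.
  by apply/negP => /strand_pred_between; rewrite rb ltnn andbF.
rewrite orbF; congr (_ ^ _); apply: bond_image_ext => // l /andP[_ kl].
by rewrite dE (ltn_eqF kl) andbF.
Qed.

Lemma braid_bond_outside k (b : bond n) :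
    (k.+1 < bond_l b) || (bond_r b < k) ->
  commute (sigman n k) (braid_bond b).
Proof.
move=> kb; apply: commute_bond; first exact: bond_lr.
by move=> l lb; apply: s_apart; [exact: sigman_far | lia].
Qed.

Lemma braid_bond_inside k (x y : 'I_n) (b c : bond n) :
    x = k :> nat -> y = k.+1 :> nat ->
    bond_l b < k -> k.+1 < bond_r b ->
    bond_l c = bond_l b -> bond_r c = bond_r b ->
    (x \in bond_set b) ==> (y \in bond_set b) ->
    (x \in bond_set c) = (y \in bond_set b) ->
    (y \in bond_set c) = (x \in bond_set b) ->
    bond_set b :\: [set x; y] = bond_set c :\: [set x; y] ->
  braid_bond b ^ sigman n k = braid_bond c.
Proof.
move=> xk yk bk kb lc rc xyb xc yc bc; rewrite /braid_bond lc rc.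
apply: (bond_image_swap _ n.-1) => //; rewrite -?yk -?xk ?strand_predE //.
- exact: sigman_far.
- exact: sigman_near.
- by have := ltn_ord (bond_r b); lia.
move=> l lx ly; rewrite /strand_pred; case: insubP => //= z _ zl.
have := congr1 (fun A : {set 'I_n} => z \in A) bc.
by rewrite !inE -!val_eqE /= zl (negbTE lx) (negbTE ly).
Qed.

Lemma braid_bond1 k (b : bond n) :
  bond_l b = k :> nat -> bond_r b = k.+1 :> nat ->
  braid_bond b = expgz (sigman n k ^+ 2) p.
Proof. by move=> lb rb; rewrite /braid_bond lb rb bond_image1. Qed.

Lemma prod_letter_image_rel u v : bonded_rel u v ->
  \prod_(x <- u) letter_image x = \prod_(x <- v) letter_image x.
Proof.
case=> {u v} [u v uv|b c bc|b c lbc rcb sets|k b c lc lb rc sc|k b c lc lb rc sc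
  |k b c rb rc lc sc|k b c rb rc lc sc|k b lb rb|k b kb|k x y b xk yk bk kb xyb
  |k x y b c xk yk bk kb lc rc xb yb xc yc bc|k l b c lk lb rb lc rc
  |k l b c lk lb rb lc rc].
  by rewrite !prod_letter_image_braid; apply: pres_word_rel.
all: rewrite /bd /ps /ns !big_cons !big_nil /= ?mulg1 ?sigmaE.
- exact: braid_bond_far.
- exact: braid_bond_nested.
- by rewrite (braid_bond_left false k b c).
- by rewrite (braid_bond_left true k b c) // conjgE invgK.
- by rewrite (braid_bond_right false k b c) // conjgE invgK.
- by rewrite (braid_bond_right true k b c).
- rewrite (braid_bond1 k) //.
  by apply/commute_expgz/commuteX/commute_refl.
- exact: braid_bond_outside.
- have [xyE yxE] : (x \in bond_set b) = (y \in bond_set b) /\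
      ((x \in bond_set b) ==> (y \in bond_set b)).
    by case: (x \in _) (y \in _) xyb => [] [].
  by apply/commute_sym/conjg_commute; apply: (braid_bond_inside _ x y).
(* The exchange needs membership of x to imply that of y; this holds for [c], so [c] is carried to
   [b]. *)
- have <- : braid_bond c ^ sigman n k = braid_bond b.
    apply: (braid_bond_inside _ x y); rewrite ?lc ?rc //.
    + by rewrite (negbTE xc).
    + by rewrite xb yc.
    + by rewrite (negbTE xc) (negbTE yb).
  by rewrite conjgE !mulgA mulgV mul1g.
all: rewrite (braid_bond1 k) // (braid_bond1 l) // lk.
all: have kn : k.+1 < n.-1 by rewrite -lk.
- by rewrite -(t_shift _ _ _ p sigman_near _ kn) [RHS]mulgA -conjgC.
- by rewrite -(t_shiftV _ _ _ p sigman_near _ kn) [LHS]mulgA -conjgC.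
Qed.

(** * The number of bonds as an invariant *)

Definition is_bond (x : bonded_letter n) : bool :=
  if x is inr _ then true else false.

Lemma count_bond_braid u : count is_bond (map inl u) = 0.
Proof. by rewrite count_map; elim: u. Qed.

Lemma count_bond_cong u v :
  pres_cong (@bonded_rel n) u v -> count is_bond u = count is_bond v.
Proof.
elim=> // [{}u {}v w z uv|{}u {}v w _ -> _ -> //]; rewrite !count_cat.
by congr (_ + (_ + _))%N; case: uv => // u' v' _; rewrite !count_bond_braid.
Qed.

End BondedBraids.

(** * The homomorphism and its properties *)

Theorem theorem4p6 (n : nat) (hn : (2 <= n)%N) (p : int) :
  exists Phi : UMagmaMorphism.type (bonded_monoid n) (braid_group n),
    [/\ @Phi_spec n p Phi,
        forall Psi : UMagmaMorphism.type (bonded_monoid n) (braid_group n),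
          @Phi_spec n p Psi -> Psi =1 Phi,
        forall y : braid_group n, exists x : bonded_monoid n, Phi x = y,
        ~ injective Phi
      & p = 0%R ->
        [/\ forall k, Phi (bsigma k) = sigma k,
            forall k, Phi (bsigmaV k) = (sigma k)^-1
          & forall b, Phi (bbond b) = 1]].
Proof.
have [Phi PhiE] := pres_morphism_exists _ _ _ _ (prod_letter_image_rel n p).
have Phi_gen x : Phi (pres_gen _ x) = letter_image n p x.
  by rewrite PhiE big_seq1.
have Phi_braid u :
    Phi (pres_word _ (map inl u)) = pres_word (group_rel (@braid_rel n)) u.
  by rewrite PhiE prod_letter_image_braid.
have Phi_bond b : Phi (bbond b) = braid_bond n p b by apply: Phi_gen.
have spec : Phi_spec p Phi.
  split=> [k|k|b b0|b]; rewrite ?Phi_bond ?braid_bondE //.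
  - exact: Phi_gen.
  - exact: Phi_gen.
  - by rewrite b0 enum_set0 !big_nil mul1g mulg1.
exists Phi; split=> //.
- move=> Psi [Psi_s Psi_sV _ Psi_b]; have [Phi_s Phi_sV _ Phi_b] := spec.
  apply: pres_morphism_ext => -[[k []]|b].
  + by rewrite [LHS]Psi_s [RHS]Phi_s.
  + by rewrite [LHS]Psi_sV [RHS]Phi_sV.
  + by rewrite [LHS]Psi_b [RHS]Phi_b.
- move=> y; have [u ->] := pres_word_surj y.
  by exists (pres_word _ (map inl u)); apply: Phi_braid.
- move=> Phi_inj.
  (* The first two strands exist as n >= 2. Their elementary bond has the same image as a bond-free
     word [u], so injectivity would equate bond counts 1 and 0. *)
  pose i0 := Ordinal (ltnW hn); pose i1 := Ordinal hn.
  have b01 : bond_axiom (i0, i1, set0) by rewrite /bond_axiom sub0set.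
  have [u Eu] := pres_word_surj (Phi (bbond (Bond b01))).
  have /pres_wordP/count_bond_cong : pres_word (@bonded_rel n) [:: bd (Bond b01)] =
      pres_word _ (map inl u).
    by apply: Phi_inj; rewrite Phi_braid.
  by rewrite count_bond_braid.
- move=> p0; have [Phi_s Phi_sV _ Phi_b] := spec; split=> // b.
  (* With the middle power equal to 1, the two outer products are mutually inverse. *)
  by rewrite Phi_b p0 /= mulg1 prodgV revK mulgV.
Qed.
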